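(* Let $A\geq a\geq 1$ and $r\geq 1$ be integers. Then, as formal power series in $q$ (equivalently for $|q|<1$) with $z$ a formal variable, \[ \sum_{\pi\in\overline{\mathcal{P}}}z^{mes_{r,A,a}(\pi)}q^{|\pi|} =\frac{(-q;q)_{\infty}}{(q;q)_{\infty}}\sum_{k=0}^{\infty}z^{kA+a}\bigg[\frac{2^kq^{r[A\binom{k}{2}+ka]}}{(-q^a;q^A)_k}-\frac{2^{k+1}q^{r[A\binom{k+1}{2}+(k+1)a]}}{(-q^a;q^A)_{k+1}}\bigg]. \]
   Context: An overpartition is a partition (finite non-increasing sequence of positive integers) in which the first occurrence of each part value may be overlined; $\overline{\mathcal{P}}$ denotes the set of all overpartitions (including the empty one) and $|\pi|$ the sum of the parts of $\pi$. A part $\pi_i$ is of size $t$ if $\pi_i=t$ or $\pi_i=\overline{t}$. $(a;q)_\infty=\prod_{i\geq0}(1-aq^i)$ and $(a;q)_n=(a;q)_\infty/(aq^n;q)_\infty$, so $(a;q)_0=1$. For $r\geq1$, $mes_{r,A,a}(\pi)$ is the smallest positive integer $\equiv a\pmod A$ such that there are fewer than $r$ parts of size $mes_{r,A,a}(\pi)$ in $\pi$ (counting overlined and non-overlined parts). *)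

(* Defs.v *)
From HB Require Import structures.
From mathcomp Require Import all_boot all_order all_algebra.
From mathcomp Require Import boolp classical_sets functions cardinality fsbigop.

Set Implicit Arguments.
Unset Strict Implicit.
Unset Printing Implicit Defensive.

Import GRing.Theory.

Local Open Scope ring_scope.

(** A series is wrapped in a record because [nat -> R] already carries the
    pointwise ring structure of [functions]. *)

Record fps (R : Type) := Fps { fps_coef : nat -> R }.

Notation "f .[[ n ]]" := (fps_coef f n)
  (at level 1, left associativity, format "f .[[ n ]]") : ring_scope.

Lemma fpsP (R : Type) (f g : fps R) : (forall n, f.[[n]] = g.[[n]]) <-> f = g.
Proof. by split=> [|-> //]; case: f g => f [g] /= /funext ->. Qed.

HB.instance Definition _ (R : Type) := gen_eqMixin (fps R).
HB.instance Definition _ (R : Type) := gen_choiceMixin (fps R).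

Definition fps_zero (R : comNzRingType) : fps R := Fps (fun=> 0).
Definition fps_opp (R : comNzRingType) (f : fps R) : fps R :=
  Fps (fun n => - f.[[n]]).
Definition fps_add (R : comNzRingType) (f g : fps R) : fps R :=
  Fps (fun n => f.[[n]] + g.[[n]]).

Fact fps_addA (R : comNzRingType) : associative (@fps_add R).
Proof. by move=> f g h; apply/fpsP => n /=; rewrite addrA. Qed.
Fact fps_addC (R : comNzRingType) : commutative (@fps_add R).
Proof. by move=> f g; apply/fpsP => n /=; rewrite addrC. Qed.
Fact fps_add0 (R : comNzRingType) : left_id (fps_zero R) (@fps_add R).
Proof. by move=> f; apply/fpsP => n /=; rewrite add0r. Qed.
Fact fps_addN (R : comNzRingType) :
  left_inverse (fps_zero R) (@fps_opp R) (@fps_add R).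
Proof. by move=> f; apply/fpsP => n /=; rewrite addNr. Qed.

HB.instance Definition _ (R : comNzRingType) :=
  GRing.isZmodule.Build (fps R)
    (@fps_addA R) (@fps_addC R) (@fps_add0 R) (@fps_addN R).

Definition fpsC (R : comNzRingType) (c : R) : fps R :=
  Fps (fun n => if n == 0%N then c else 0).
Definition fps_mul (R : comNzRingType) (f g : fps R) : fps R :=
  Fps (fun n => \sum_(i < n.+1) f.[[i]] * g.[[n - i]]).

Lemma fps_mul_poly (R : comNzRingType) (f g : fps R) (N n : nat) : (n < N)%N ->
  (fps_mul f g).[[n]] =
    ((\poly_(i < N) f.[[i]]) * (\poly_(i < N) g.[[i]]))`_n.
Proof.
move=> ltnN; rewrite coefM /=; apply: eq_bigr => i _; rewrite !coef_poly.
rewrite (leq_ltn_trans (leq_ord i) ltnN).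
by rewrite (leq_ltn_trans (leq_subr i n) ltnN).
Qed.

Fact fps_mulC (R : comNzRingType) : commutative (@fps_mul R).
Proof.
by move=> f g; apply/fpsP => n; rewrite !(@fps_mul_poly _ _ _ n.+1) // mulrC.
Qed.
Fact fps_mulA (R : comNzRingType) : associative (@fps_mul R).
Proof.
have aux (f g h : fps R) n : (fps_mul f (fps_mul g h)).[[n]] =
    ((\poly_(i < n.+1) f.[[i]]) *
     ((\poly_(i < n.+1) g.[[i]]) * (\poly_(i < n.+1) h.[[i]])))`_n.
  rewrite coefM /=; apply: eq_bigr => i _; rewrite coef_poly ltn_ord.
  by rewrite -fps_mul_poly // ltnS leq_subr.
move=> f g h; apply/fpsP => n.
by rewrite aux fps_mulC aux mulrA mulrC.
Qed.
Fact fps_mul1 (R : comNzRingType) : left_id (fpsC (1 : R)) (@fps_mul R).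
Proof.
move=> f; apply/fpsP => n /=; rewrite big_ord_recl /= mul1r subn0.
by rewrite big1 ?addr0 // => i _; rewrite mul0r.
Qed.
Fact fps_mulDl (R : comNzRingType) :
  left_distributive (@fps_mul R) (@fps_add R).
Proof.
move=> f g h; apply/fpsP => n /=; rewrite -big_split /=.
by apply: eq_bigr => i _; rewrite mulrDl.
Qed.
Fact fps_1neq0 (R : comNzRingType) : fpsC (1 : R) != 0.
Proof.
by apply/eqP => /fpsP/(_ 0%N) /= /eqP; rewrite (negbTE (oner_neq0 R)).
Qed.

HB.instance Definition _ (R : comNzRingType) :=
  GRing.Zmodule_isComNzRing.Build (fps R)
    (@fps_mulA R) (@fps_mulC R) (@fps_mul1 R) (@fps_mulDl R) (@fps_1neq0 R).

Definition fps_unit (R : comNzRingType) : {pred fps R} :=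
  fun f => `[< exists g, g * f = 1 >].
Definition fps_inv (R : comNzRingType) (f : fps R) : fps R :=
  xget f [set g | g * f = 1]%classic.

Fact fps_mulV (R : comNzRingType) :
  {in @fps_unit R, left_inverse 1 (@fps_inv R) *%R}.
Proof. by move=> f /asboolP; apply: xgetPex. Qed.
Fact fps_unitPl (R : comNzRingType) (f g : fps R) : g * f = 1 -> fps_unit f.
Proof. by move=> gf1; apply/asboolP; exists g. Qed.
Fact fps_inv_out (R : comNzRingType) :
  {in [predC @fps_unit R], @fps_inv R =1 id}.
Proof.
move=> f /asboolPn nu; rewrite /fps_inv xgetPN // => g gf1.
by apply: nu; exists g.
Qed.

HB.instance Definition _ (R : comNzRingType) :=
  GRing.ComNzRing_hasMulInverse.Build (fps R)
    (@fps_mulV R) (@fps_unitPl R) (@fps_inv_out R).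

Definition fpsX (R : comNzRingType) : fps R :=
  Fps (fun n => if n == 1%N then 1 else 0).

(** Coefficientwise (that is, 'X-adic) limit: the n-th coefficient is the
    eventual value of the n-th coefficients, and 0 if they do not stabilize. *)
Definition fps_lim (R : comNzRingType) (u : nat -> fps R) : fps R :=
  Fps (fun n => xget 0 [set c | exists N, forall m, (N <= m)%N ->
                                 (u m).[[n]] = c]%classic).

Definition fps_prod (R : comNzRingType) (f : nat -> fps R) : fps R :=
  fps_lim (fun m => \prod_(i < m) f i).

(** Sum of a family of series in which each coefficient involves finitely many
    members only ([fps_summable]); [\sum_(i \in _)] is the finitely supported
    sum of [fsbigop]. *)
Definition fps_summable (R : comNzRingType) (I : choiceType) (F : I -> fps R) :=
  forall n, finite_set [set i | (F i).[[n]] <> 0]%classic.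

Definition fps_sum (R : comNzRingType) (I : choiceType) (F : I -> fps R) :
  fps R := Fps (fun n => \sum_(i \in [set: I]%classic) (F i).[[n]]).

Definition qpochinf (R : comNzRingType) (x y : fps R) : fps R :=
  fps_prod (fun i => 1 - x * y ^+ i).

Definition qpoch (R : comNzRingType) (x y : fps R) (n : nat) : fps R :=
  qpochinf x y / qpochinf (x * y ^+ n) y.

(** A part is a pair (size, overlined?). *)

Definition is_overpartition (s : seq (nat * bool)) : bool :=
  [&& all (fun x => 0 < x.1)%N s, sorted geq [seq x.1 | x <- s]
    & pairwise (fun x y => (x.1 == y.1) ==> ~~ y.2) s].

Record overpartition :=
  Overpartition { parts :> seq (nat * bool); _ : is_overpartition parts }.

HB.instance Definition _ := [isSub for parts].
HB.instance Definition _ := [Choice of overpartition by <:].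

Definition weight (p : overpartition) : nat := sumn [seq x.1 | x <- p].

Definition nparts (p : overpartition) (t : nat) : nat :=
  count (fun x => x.1 == t) p.

Definition mes_cond (r A a : nat) (p : overpartition) (m : nat) : Prop :=
  [/\ (0 < m)%N, m = a %[mod A] & (nparts p m < r)%N].

Definition mes (r A a : nat) (p : overpartition) : nat :=
  xget 0%N [set m | mes_cond r A a p m /\
                    forall m', mes_cond r A a p m' -> (m <= m')%N]%classic.

Definition q : fps {poly int} := fpsX {poly int}.
Definition z : fps {poly int} := fpsC 'X.

Arguments fps_coef : simpl never.

Lemma fps_coefM (R : comNzRingType) (f g : fps R) n :
  (f * g).[[n]] = \sum_(i < n.+1) f.[[i]] * g.[[n - i]].
Proof. by []. Qed.

Lemma fps_coefD (R : comNzRingType) (f g : fps R) n :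
  (f + g).[[n]] = f.[[n]] + g.[[n]].
Proof. by []. Qed.

Lemma fps_coefN (R : comNzRingType) (f : fps R) n : (- f).[[n]] = - f.[[n]].
Proof. by []. Qed.

Lemma fps_coef1 (R : comNzRingType) n :
  (1 : fps R).[[n]] = if n == 0%N then 1 else 0.
Proof. by []. Qed.

Lemma fps_coef0M (R : comNzRingType) (f g : fps R) :
  (f * g).[[0]] = f.[[0]] * g.[[0]].
Proof. by rewrite fps_coefM big_ord1. Qed.

Definition fps_vanish (R : comNzRingType) (k : nat) (f : fps R) :=
  forall n, (n < k)%N -> f.[[n]] = 0.

Lemma fps_vanishM (R : comNzRingType) j k (f g : fps R) :
  fps_vanish j f -> fps_vanish k g -> fps_vanish (j + k) (f * g).
Proof.
move=> vf vg n ltn; rewrite fps_coefM big1 // => i _.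
have [ij|ji] := ltnP i j; first by rewrite vf // mul0r.
by rewrite vg ?mulr0 // ltn_subLR ?leq_ord // (leq_trans ltn) // leq_add2r.
Qed.

Lemma fps_vanishMl (R : comNzRingType) k (f g : fps R) :
  fps_vanish k g -> fps_vanish k (f * g).
Proof. by move=> vg; apply: (@fps_vanishM _ 0). Qed.

Lemma fps_vanishX (R : comNzRingType) (y : fps R) k :
  y.[[0]] = 0 -> fps_vanish k (y ^+ k).
Proof.
move=> y0; elim: k => [//|k IH]; rewrite exprS -add1n.
by apply: fps_vanishM IH => -[].
Qed.

Lemma fps_vanishN (R : comNzRingType) k (f : fps R) :
  fps_vanish k f -> fps_vanish k (- f).
Proof. by move=> vf n /vf; rewrite fps_coefN => ->; rewrite oppr0. Qed.

Lemma fps_unit_coef0 (R : comNzRingType) (f : fps R) :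
  f.[[0]] = 1 -> f \is a GRing.unit.
Proof.
move=> f0.
pose fix S n := if n is m.+1 then
    rcons (S m) ((m == 0%N)%:R - \sum_(i < m) (S m)`_i * f.[[m - i]])
  else [::].
have sizeS n : size (S n) = n by elim: n => //= n IH; rewrite size_rcons IH.
have nthS n m i : (i < n <= m)%N -> (S m)`_i = (S n)`_i.
  move=> /andP[ltin]; elim: m => [|m IH]; first by case: n ltin.
  rewrite leq_eqVlt => /predU1P[-> //|]; rewrite ltnS => lenm.
  by rewrite /= nth_rcons sizeS (leq_trans ltin lenm) IH.
suff H : Fps (fun n => (S n.+1)`_n) * f = 1.
  by apply/unitrP; exists (Fps (fun n => (S n.+1)`_n)); split=> //; rewrite mulrC.
apply/fpsP => n; rewrite fps_coefM big_ord_recr /= subnn f0 mulr1 /fps_coef /=.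
rewrite nth_rcons sizeS ltnn eqxx.
under eq_bigr => i _.
  rewrite -[rcons _ _]/(S i.+1) -(@nthS i.+1 n) ?ltnSn ?ltn_ord //=.
  over.
by rewrite addrC subrK; case: (n == 0%N).
Qed.

Lemma fps_limE (R : comNzRingType) (u : nat -> fps R) n N c :
  (forall m, (N <= m)%N -> (u m).[[n]] = c) -> (fps_lim u).[[n]] = c.
Proof.
move=> uc; apply: xget_unique; first by exists N.
move=> d [M ud]; rewrite -(ud (maxn N M) (leq_maxr _ _)).
by rewrite uc // leq_maxl.
Qed.

Lemma qpochinfE (R : comNzRingType) (x y : fps R) n m :
  y.[[0]] = 0 -> (n < m)%N ->
  (qpochinf x y).[[n]] = (\prod_(i < m) (1 - x * y ^+ i)).[[n]].
Proof.
move=> y0 ltnm; apply: (@fps_limE _ _ _ m) => k; elim: k => [|k IH].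
  by case: m ltnm.
rewrite leq_eqVlt => /predU1P[-> //|]; rewrite ltnS => lemk.
rewrite big_ord_recr /= mulrBr mulr1.
rewrite fps_coefD fps_coefN IH //.
suff -> : (\prod_(i < k) (1 - x * y ^+ i) * (x * y ^+ k)).[[n]] = 0.
  by rewrite oppr0 addr0.
apply: (_ : fps_vanish k _); last exact: leq_trans ltnm lemk.
by do 2!apply: fps_vanishMl; apply: fps_vanishX.
Qed.

Lemma qpochinf_coef0 (R : comNzRingType) (x y : fps R) :
  x.[[0]] = 0 -> y.[[0]] = 0 -> (qpochinf x y).[[0]] = 1.
Proof.
move=> x0 y0; rewrite (@qpochinfE _ _ _ 0 1) // big_ord1 expr0 mulr1.
by rewrite fps_coefD fps_coefN x0 subr0.
Qed.

Lemma qpochinf_unit (R : comNzRingType) (x y : fps R) :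
  x.[[0]] = 0 -> y.[[0]] = 0 -> qpochinf x y \is a GRing.unit.
Proof. by move=> x0 y0; apply/fps_unit_coef0/qpochinf_coef0. Qed.

Lemma qpochE (R : comNzRingType) (x y : fps R) n :
  x.[[0]] = 0 -> y.[[0]] = 0 ->
  qpoch x y n = \prod_(i < n) (1 - x * y ^+ i).
Proof.
move=> x0 y0; rewrite /qpoch.
suff -> : qpochinf x y =
    \prod_(i < n) (1 - x * y ^+ i) * qpochinf (x * y ^+ n) y.
  by rewrite mulrK // qpochinf_unit // fps_coef0M x0 mul0r.
apply/fpsP => k; rewrite (@qpochinfE _ _ _ k (n + k.+1)) ?ltn_addl //.
rewrite big_split_ord /=.
rewrite !fps_coefM; apply: eq_bigr => i _; congr (_ * _).
rewrite (@qpochinfE _ _ _ _ k.+1) ?ltnS ?leq_subr //.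
congr (_ .[[ _ ]]); apply: eq_bigr => j _.
by rewrite -mulrA -exprD.
Qed.

Lemma qpoch_unit (R : comNzRingType) (x y : fps R) n :
  x.[[0]] = 0 -> y.[[0]] = 0 -> qpoch x y n \is a GRing.unit.
Proof.
move=> x0 y0; rewrite /qpoch unitrM unitrV !qpochinf_unit //.
by rewrite fps_coef0M x0 mul0r.
Qed.

Lemma nparts_gt0_le (p : overpartition) t :
  (0 < nparts p t)%N -> (t <= weight p)%N.
Proof.
rewrite /nparts /weight -has_count; elim: (parts p) => //= x s IH.
case/orP=> [/eqP -> | /IH le]; first exact: leq_addr.
exact: leq_trans le (leq_addl _ _).
Qed.

Lemma mesP (r A a : nat) (p : overpartition) : (0 < A)%N -> (0 < r)%N ->
  mes_cond r A a p (mes r A a p) /\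
  forall m, mes_cond r A a p m -> (mes r A a p <= m)%N.
Proof.
move=> A0 r0; rewrite /mes; set P := [set m | _]%classic.
suff /(xgetPex 0%N) : exists m, P m by [].
have ex : exists m, (fun m => `[< mes_cond r A a p m >]) m.
  exists (a + (weight p).+1 * A)%N; apply/asboolP; split.
  - by rewrite addn_gt0 muln_gt0 A0 orbT.
  - by rewrite addnC modnMDl.
  - rewrite (_ : nparts _ _ = 0%N) //; apply/eqP; rewrite -leqn0 leqNgt.
    apply/negP => /nparts_gt0_le; apply/negP; rewrite -ltnNge.
    by rewrite ltn_addl // leq_pmulr.
case: (ex_minnP ex) => m /asboolP mP mmin; exists m; split=> // m' /asboolP.
exact: mmin.
Qed.

Lemma finite_weight_le n : finite_set [set p | (weight p <= n)%N]%classic.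
Proof.
pose T := (n.-bseq ('I_n.+1 * bool))%type.
pose h (t : T) : seq (nat * bool) := [seq (nat_of_ord x.1, x.2) | x <- t].
have fh : finite_set (range h)%classic by apply/finite_image/finite_finset.
apply: (@sub_finite_set _ _ (parts @^-1` range h)%classic); last first.
  by apply: finite_preimage fh => x y _ _; exact: val_inj.
move=> p /= wp.
have le_s (s : seq (nat * bool)) x : x \in s ->
    (x.1 <= sumn [seq y.1 | y <- s])%N.
  elim: s => //= y s IH; rewrite inE => /predU1P[->|/IH le].
    exact: leq_addr.
  exact: leq_trans le (leq_addl _ _).
have sz : (size (parts p) <= n)%N.
  apply: leq_trans wp; case: p => s /= ps; rewrite /weight /=.
  case/andP: ps => pos _.
  by elim: s pos => //= x s IH /andP[x0 /IH le]; rewrite -add1n leq_add.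
pose t0 : seq ('I_n.+1 * bool) := [seq (inord x.1, x.2) | x <- p].
have szt : (size t0 <= n)%N by rewrite size_map.
exists (Bseq szt) => //=; rewrite /h /= /t0 -map_comp.
rewrite -[RHS]map_id; apply/eq_in_map => x xp /=.
rewrite inordK; first by case: x {xp}.
by rewrite ltnS (leq_trans (le_s _ _ xp) wp).
Qed.

Lemma q_vanish k : fps_vanish k (q ^+ k).
Proof. exact: fps_vanishX. Qed.

Lemma mes_lhs_summable (r A a : nat) :
  fps_summable (fun p : overpartition => z ^+ mes r A a p * q ^+ weight p).
Proof.
move=> n; apply: sub_finite_set (finite_weight_le n) => p /= nz.
rewrite leqNgt; apply/negP => lt; apply: nz.
by move: lt; apply: fps_vanishMl; apply: q_vanish.
Qed.

Lemma mes_rhs_summable (r A a : nat) : (0 < a)%N -> (0 < r)%N ->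
  fps_summable (fun k : nat =>
    z ^+ (k * A + a) *
    (2 ^+ k * q ^+ (r * (A * 'C(k, 2) + k * a)) / qpoch (- q ^+ a) (q ^+ A) k
     - 2 ^+ k.+1 * q ^+ (r * (A * 'C(k.+1, 2) + k.+1 * a))
       / qpoch (- q ^+ a) (q ^+ A) k.+1)).
Proof.
move=> a0 r0 n.
apply: sub_finite_set (finite_II n.+1) => k nz.
rewrite /= ltnNge; apply/negP => lt; apply: nz.
move: lt; apply: fps_vanishMl => m ltmk; rewrite fps_coefD fps_coefN.
have vanish j c d : (k <= j)%N ->
    (c * q ^+ (r * (A * 'C(j, 2) + j * a)) / d).[[m]] = 0.
  move=> kj; rewrite mulrAC.
  suff: (m < r * (A * 'C(j, 2) + j * a))%N.
    by apply: fps_vanishMl; apply: q_vanish.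
  apply: leq_trans ltmk _; apply: leq_trans kj _.
  apply: leq_trans (leq_pmulr j a0) _.
  by apply: leq_trans (leq_pmull _ r0); apply: leq_addl.
rewrite [X in X - _](vanish k _ _ (leqnn k)) sub0r.
by rewrite [X in - X](vanish k.+1 _ _ (leqnSn k)) oppr0.
Qed.

(* Main.v *)
(** Fix a part size t and a condition C on overpartitions that does not involve
    parts of size t, and let U be the generating function of the overpartitions
    satisfying C without overlined t. Adding or removing an overlined t shows
    that C alone has generating function (1 + q^t) U; adding or removing plain
    parts t gives (1 - q^t) U when no part of size t is allowed and
    2 q^(mt) U when at least m >= 1 parts of size t are required.
    Comparing the first two for t = 1, 2, ... yields (-q; q)_oo / (q; q)_oo for
    all overpartitions. Comparing the first and third for t = a, A + a, ... shows
    that requiring at least r parts of each of the sizes jA + a, j < k,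
    multiplies this by 2^k q^(r (A C(k,2) + ka)) / (-q^a; q^A)_k. The k-th
    bracket of the theorem is then the difference of two consecutive such
    series, which counts the overpartitions whose mes is kA + a. *)

Require Import Defs.
From mathcomp Require Import all_boot all_order all_algebra.
From mathcomp Require Import boolp classical_sets cardinality fsbigop.
From mathcomp Require Import finmap zify ring.

Set Implicit Arguments.
Unset Strict Implicit.
Unset Printing Implicit Defensive.

Import GRing.Theory.
Local Open Scope ring_scope.

(** * Overpartitions as multisets of parts *)

(** This relation is reflexive on plain parts only, so a pairwise related list may repeat a plain
    part but never an overlined one. It thus merges the sorting and overlining conditions. *)
Definition part_before (x y : nat * bool) : bool :=
  (y.1 < x.1)%N || ((x.1 == y.1) && ~~ y.2).

Lemma part_before_trans : transitive part_before.
Proof.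
by move=> [y b] [x c] [u d]; rewrite /part_before /=; case: b d => -[]; lia.
Qed.

Lemma part_before_anti : antisymmetric part_before.
Proof.
move=> [x c] [y b]; rewrite /part_before /= => H.
have -> : x = y by case: b c H => -[]; lia.
by congr pair; case: b c H => -[]; lia.
Qed.

Lemma is_overpartitionE s :
  is_overpartition s = all (fun x => 0 < x.1)%N s && pairwise part_before s.
Proof.
rewrite /is_overpartition sorted_map sorted_pairwise; last first.
  by move=> y x u /= /[swap]; apply: leq_trans.
rewrite -pairwise_relI; congr (_ && _); apply: eq_pairwise => x y /=.
by rewrite /part_before; case: (y.2); lia.
Qed.

(** A list sorted for a transitive antisymmetric relation is fixed by its multiset of entries.
    Bijections can therefore be checked up to [perm_eq]. *)
Lemma overpartition_perm (p p' : overpartition) : perm_eq p p' -> p = p'.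
Proof.
have sort_p (s : overpartition) : sorted part_before s.
  case: s => s /=; rewrite is_overpartitionE => /andP[_].
  by rewrite sorted_pairwise //; apply: part_before_trans.
move=> pp'; apply: val_inj.
exact: sorted_eq part_before_trans part_before_anti _ _ (sort_p p) (sort_p p') pp'.
Qed.

Lemma perm_weight (p : overpartition) (s : seq (nat * bool)) :
  perm_eq p s -> weight p = sumn [seq x.1 | x <- s].
Proof. by move=> pe; apply/perm_sumn/perm_map. Qed.

Lemma count_overlined (p : overpartition) t : (count_mem (t, true) p <= 1)%N.
Proof.
case: p => s /=; rewrite is_overpartitionE => /andP[_].
elim: s => //= x s IH /andP[/allP xs /IH {}IH].
case: eqP xs => // -> xs; rewrite (_ : count_mem _ _ = 0%N) //.
by apply/count_memPn/negP => /xs; rewrite /part_before /= ltnn andbF.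
Qed.

Lemma nparts_count_mem (p : overpartition) t :
  nparts p t = (count_mem (t, true) p + count_mem (t, false) p)%N.
Proof.
rewrite -count_predUI [X in (_ + X)%N](_ : _ = 0%N) ?addn0; last first.
  apply/eqP; rewrite -leqn0 leqNgt -has_count.
  by apply/hasP => -[x _ /andP[/eqP -> /eqP] ].
apply: eq_count => -[s b] /=; rewrite !xpair_eqE /=.
by case: b; rewrite ?andbT ?andbF ?orbF.
Qed.

(** If the insertion fails to give an overpartition, the value is [p] itself; the hypotheses of
    [add_partP] exclude this. *)
Definition add_part (x : nat * bool) (p : overpartition) : overpartition :=
  insubd p ([seq y <- p | part_before y x] ++
            x :: [seq y <- p | ~~ part_before y x]).

Definition rem_part (x : nat * bool) (p : overpartition) : overpartition :=
  insubd p (rem x p).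

Lemma add_partP (x : nat * bool) (p : overpartition) :
  (0 < x.1)%N -> (x.2 -> x \notin parts p) -> perm_eq (add_part x p) (x :: p).
Proof.
move=> x0 xp; rewrite /add_part insubdK.
  by rewrite (perm_catCA _ [:: x]) perm_cons; apply/permPl/perm_filterC.
case: p xp => s /= + xs; rewrite is_overpartitionE => ps.
rewrite -[_ \in _]/(is_overpartition _) is_overpartitionE.
case/andP: ps => s0 prs; rewrite all_cat /= x0 !all_filter.
rewrite (sub_all _ s0) => [|y y0]; last by rewrite /= y0 implybT.
rewrite (sub_all _ s0) => [|y y0]; last by rewrite /= y0 implybT.
(* Any two parts are related in at least one direction, except an overlined part with itself; that
   case is excluded because an overlined [x] is absent from [s]. *)
have xR : all (part_before x) [seq y <- s | ~~ part_before y x].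
  rewrite all_filter; apply/allP => -[y c] ys; apply/implyP.
  case: x xs {x0} => t b /= xs; rewrite /part_before /=.
  case: b c xs ys => -[] // xs; try lia.
  move=> ys; suff: y != t by lia.
  by apply: contraTneq ys => ->; apply: xs.
rewrite pairwise_cat /= xR !(subseq_pairwise (filter_subseq _ _)) // !andbT.
apply/allrelP => y u; rewrite mem_filter inE => /andP[yx _] /predU1P[->//|].
by move=> /(allP xR); apply: part_before_trans.
Qed.

Lemma rem_partP (x : nat * bool) (p : overpartition) :
  x \in parts p -> perm_eq p (x :: rem_part x p).
Proof.
move=> xp; rewrite /rem_part insubdK; first exact: perm_to_rem.
case: p {xp} => s /=; rewrite is_overpartitionE => /andP[s0 prs].
rewrite -[_ \in _]/(is_overpartition _) is_overpartitionE.
rewrite (subseq_pairwise (rem_subseq _ _) prs) andbT.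
by apply/allP => y /mem_rem /(allP s0).
Qed.

(** * Generating functions and insertion of a part *)

Definition overpartitions_of (n : nat) : seq overpartition :=
  fset_set [set p | weight p = n]%classic.

Lemma mem_overpartitions_of n p : (p \in overpartitions_of n) = (weight p == n).
Proof.
rewrite in_fset_set; last first.
  by apply: sub_finite_set (finite_weight_le n) => u /= ->.
by apply/idP/eqP => [/set_mem //|wp]; apply/mem_set.
Qed.

Lemma overpartitions_of_uniq n : uniq (overpartitions_of n).
Proof. exact: fset_uniq. Qed.

Definition gf (C : pred overpartition) : fps {poly int} :=
  Fps (fun n => (count C (overpartitions_of n))%:R).

Lemma gf_coef C n : (gf C).[[n]] = (count C (overpartitions_of n))%:R.
Proof. by []. Qed.

Lemma eq_gf C D : C =1 D -> gf C = gf D.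
Proof. by move=> CD; apply/fpsP => n; rewrite !gf_coef (eq_count CD). Qed.

Lemma gfID (D C : pred overpartition) :
  gf C = gf (fun p => C p && D p) + gf (fun p => C p && ~~ D p).
Proof.
apply/fpsP => n; rewrite fps_coefD !gf_coef -natrD; congr (_ %:R).
by elim: (overpartitions_of n) => //= p s ->; case: (C p) (D p) => -[]; lia.
Qed.

Lemma coef_q n : q.[[n]] = if n == 1%N then 1 else 0.
Proof. by []. Qed.

Lemma coef_qXM t (f : fps {poly int}) n :
  (q ^+ t * f).[[n]] = if (n < t)%N then 0 else f.[[n - t]].
Proof.
elim: t n => [|t IH] n; first by rewrite expr0 mul1r subn0.
rewrite exprS -mulrA fps_coefM; case: n => [|n].
  by rewrite big_ord1 coef_q mul0r.
rewrite big_ord_recl big_ord_recl big1 ?addr0 => [|i _]; last first.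
  by rewrite coef_q mul0r.
by rewrite !coef_q /= mul0r add0r mul1r subn1 IH ltnS subSS.
Qed.

(** The hypotheses make insertion of [x] a bijection from [S] onto [T], with removal of [x] as
    inverse, and it raises the weight by [x.1]. *)
Lemma gf_add_part (x : nat * bool) (S T : pred overpartition) : (0 < x.1)%N ->
  (forall p, S p -> x.2 -> x \notin parts p) ->
  (forall p p' : overpartition, S p -> perm_eq p' (x :: p) -> T p') ->
  (forall p, T p -> x \in parts p) ->
  (forall p p' : overpartition, T p' -> perm_eq p' (x :: p) -> S p) ->
  gf T = q ^+ x.1 * gf S.
Proof.
move=> x0 Sx ST Tx TS; apply/fpsP => n; rewrite coef_qXM !gf_coef.
have wx (p p' : overpartition) :
    perm_eq p' (x :: p) -> weight p' = (x.1 + weight p)%N.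
  exact: perm_weight.
case: ltnP => [nx|xn].
  rewrite (_ : count _ _ = 0%N) //; apply/eqP; rewrite -leqn0 leqNgt -has_count.
  apply/hasP => -[p]; rewrite mem_overpartitions_of => /eqP wp.
  by move=> /Tx /rem_partP /wx; lia.
congr (_ %:R); rewrite -!size_filter -[RHS](size_map (add_part x)).
apply/perm_size/uniq_perm.
- by rewrite filter_uniq // overpartitions_of_uniq.
- rewrite map_inj_in_uniq ?filter_uniq ?overpartitions_of_uniq // => p p'.
  rewrite !mem_filter => /andP[Sp _] /andP[Sp' _] pp'.
  apply: overpartition_perm; rewrite -(perm_cons x).
  have := add_partP x0 (Sx _ Sp); rewrite perm_sym => /perm_trans; apply.
  by rewrite pp'; apply: add_partP x0 (Sx _ Sp').
move=> p; rewrite mem_filter mem_overpartitions_of; apply/andP/mapP => [[Tp wp]|].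
  exists (rem_part x p).
    have pr := rem_partP (Tx _ Tp).
    rewrite mem_filter mem_overpartitions_of (TS _ _ Tp pr) /=.
    by move: (wx _ _ pr) wp; lia.
  have pr := rem_partP (Tx _ Tp).
  apply: overpartition_perm; apply: (perm_trans pr); rewrite perm_sym.
  exact: add_partP x0 (Sx _ (TS _ _ Tp pr)).
move=> [u]; rewrite mem_filter mem_overpartitions_of => /andP[Su wu] ->.
have pr := add_partP x0 (Sx _ Su); split; first exact: ST pr.
by rewrite (wx _ _ pr); move: wu; lia.
Qed.

(** * Conditions on the parts of a single size *)

Definition insensitive_to (t : nat) (C : pred overpartition) : Prop :=
  forall (x : nat * bool) (p p' : overpartition),
    x.1 = t -> perm_eq p' (x :: p) -> C p' = C p.

Section OnePartSize.

Variables (t : nat) (C : pred overpartition).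
Hypotheses (t_gt0 : (0 < t)%N) (Ct : insensitive_to t C).

Let U := gf (fun p => C p && ((t, true) \notin parts p)).

Lemma gf_overlined : gf (fun p => C p && ((t, true) \in parts p)) = q ^+ t * U.
Proof.
apply: (gf_add_part (x := (t, true))) => //=.
- by move=> p /andP[].
- move=> p p' /andP[Cp _] pp'; rewrite (Ct _ pp') // Cp (perm_mem pp') inE eqxx //.
- by move=> p /andP[].
- move=> p p' /andP[Cp' _] pp'; rewrite -(Ct _ pp') // Cp' /=.
  have := count_overlined p' t; rewrite (permP pp') /= eqxx add1n ltnS leqn0.
  by move=> /eqP/count_memPn.
Qed.

Lemma gf_free : gf C = (1 + q ^+ t) * U.
Proof.
by rewrite (gfID (fun p => (t, true) \in parts p)) gf_overlined mulrDl mul1r addrC.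
Qed.

(** Both cases contribute [q ^+ t * U]: with an overlined [t], remove it; without one, remove a
    plain [t]. *)
Lemma gf_present : gf (fun p => C p && (0 < nparts p t)%N) = 2 * q ^+ t * U.
Proof.
rewrite (gfID (fun p => (t, true) \in parts p)).
rewrite (_ : gf _ = q ^+ t * U); last first.
  rewrite -gf_overlined; apply: eq_gf => p; rewrite -andbA; congr (_ && _).
  apply: andb_idl => tp; rewrite -has_count; apply/hasP; exists (t, true) => //=.
rewrite [X in _ + X](_ : _ = q ^+ t * U); first by ring.
apply: (gf_add_part (x := (t, false))) => //=.
- move=> p p' /andP[Cp tp] pp'; rewrite (Ct _ pp') // Cp (perm_mem pp') inE /=.
  by rewrite xpair_eqE andbF /= tp andbT /nparts (permP pp') /= eqxx.
- move=> p /andP[/andP[_ np] ] /count_memPn tp.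
  by move: np; rewrite nparts_count_mem tp -has_count has_pred1.
- move=> p p' /andP[/andP[Cp' _] ]; move=> + pp'; rewrite -(Ct _ pp') // Cp'.
  by rewrite (perm_mem pp') inE /= xpair_eqE andbF.
Qed.

(** This is the complement of [gf_present] in [gf_free]: [(1 + q ^+ t) - 2 * q ^+ t]. *)
Lemma gf_absent : gf (fun p => C p && (nparts p t == 0%N)) = (1 - q ^+ t) * U.
Proof.
have := gfID (fun p => (0 < nparts p t)%N) C; rewrite gf_present gf_free.
rewrite (eq_gf (D := fun p => C p && (nparts p t == 0%N))) => [|p]; last first.
  by rewrite -leqNgt leqn0.
by move=> h; rewrite -[LHS](addKr (2 * q ^+ t * U)) -h; ring.
Qed.

Lemma gf_atleast m :
  gf (fun p => C p && (m < nparts p t)%N) = 2 * q ^+ (m.+1 * t) * U.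
Proof.
elim: m => [|m IH]; first by rewrite mul1n gf_present.
rewrite (_ : gf _ = q ^+ t * gf (fun p => C p && (m < nparts p t)%N)).
  by rewrite IH (mulSn m.+1) exprD; ring.
apply: (gf_add_part (x := (t, false))) => //=.
- move=> p p' /andP[Cp tp] pp'.
  by rewrite (Ct _ pp') // Cp /nparts (permP pp') /= eqxx.
(* At least two parts of size [t] are present and at most one is overlined, so a plain one can be
   removed. *)
- move=> p /andP[_]; apply: contraLR => /count_memPn tp.
  rewrite nparts_count_mem tp addn0 -leqNgt.
  exact: leq_trans (count_overlined p t) _.
- move=> p p' /andP[Cp tp] pp'; rewrite -(Ct _ pp') // Cp /=.
  by move: tp; rewrite /nparts (permP pp') /= eqxx.
Qed.

End OnePartSize.

(** * The product formula for all overpartitions *)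

Definition parts_le (N : nat) (p : overpartition) : bool :=
  all (fun x => x.1 <= N)%N p.

Lemma parts_le_weight (p : overpartition) n : (weight p <= n)%N -> parts_le n p.
Proof.
move=> wp; apply/allP => x xp; apply: leq_trans (nparts_gt0_le _) wp.
by rewrite -has_count; apply/hasP; exists x.
Qed.

Lemma gf_parts_le0 : gf (parts_le 0) = 1.
Proof.
pose p0 : overpartition := @Overpartition [::] isT.
have pE p : parts_le 0 p = (p == p0).
  apply/idP/eqP => [|-> //]; case: p => -[|x s] ps; last first.
    have /and3P[/= /andP[/lt0n_neq0 x0 _] _ _] := ps.
    by rewrite /parts_le /= leqn0 (negbTE x0).
  by move=> _; apply: val_inj.
apply/fpsP => n; rewrite gf_coef fps_coef1 (eq_count pE).
rewrite (@count_uniq_mem _ _ p0) ?overpartitions_of_uniq // mem_overpartitions_of.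
by rewrite eq_sym; case: ifP.
Qed.

(** With [U] as above for size [N.+1], both sides equal [(1 + q ^+ N.+1) * (1 - q ^+ N.+1) * U]. *)
Lemma gf_parts_leS N :
  gf (parts_le N.+1) * (1 - q ^+ N.+1) = gf (parts_le N) * (1 + q ^+ N.+1).
Proof.
have C : insensitive_to N.+1 (parts_le N.+1).
  by move=> x p p' xN pp'; rewrite /parts_le (perm_all _ pp') /= xN leqnn.
have -> : gf (parts_le N) =
    gf (fun p => parts_le N.+1 p && (nparts p N.+1 == 0%N)).
  apply: eq_gf => p; rewrite /parts_le /nparts -leqn0 leqNgt -has_count -all_predC.
  by rewrite -all_predI; apply: eq_all => x /=; lia.
by rewrite (gf_free _ C) // (gf_absent _ C) //; ring.
Qed.

Lemma gf_parts_le N :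
  gf (parts_le N) * \prod_(i < N) (1 - q * q ^+ i) =
  \prod_(i < N) (1 - - q * q ^+ i).
Proof.
elim: N => [|N IH]; first by rewrite !big_ord0 mulr1 gf_parts_le0.
rewrite !big_ord_recr /= -IH mulNr opprK -!exprS mulrCA gf_parts_leS.
by rewrite mulrCA mulrA.
Qed.

Lemma gf_predT : gf xpredT = qpochinf (- q) q / qpochinf q q.
Proof.
suff <- : gf xpredT * qpochinf q q = qpochinf (- q) q.
  by rewrite mulrK // qpochinf_unit.
(* Up to degree [n], the factors beyond the first [n.+1] have no effect, and no part exceeds
   [n.+1]. *)
apply/fpsP => n; rewrite (@qpochinfE _ _ _ n n.+1) // -gf_parts_le.
rewrite !fps_coefM; apply: eq_bigr => i _; congr (_ * _); last first.
  by rewrite (@qpochinfE _ _ _ _ n.+1) // ltnS leq_subr.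
rewrite !gf_coef; congr (_ %:R); apply: eq_in_count => p.
rewrite mem_overpartitions_of => /eqP wp; apply/esym/parts_le_weight.
by rewrite wp ltnW // ltn_ord.
Qed.

(** * Overpartitions with a prescribed lower bound on [mes] *)

(** For [0 < a <= A] and [0 < r] this amounts to [k * A + a <= mes r A a p], as [mes_index]
    shows. *)
Definition mes_ge (r A a k : nat) (p : overpartition) : bool :=
  all (fun j => r <= nparts p (j * A + a))%N (iota 0 k).

Lemma mes_geS r A a k p :
  mes_ge r A a k.+1 p = mes_ge r A a k p && (r <= nparts p (k * A + a))%N.
Proof. by rewrite /mes_ge -addn1 iotaD all_cat /= add0n andbT. Qed.

Section Mes.

Variables (A a r : nat).
Hypotheses (a_gt0 : (0 < a)%N) (le_aA : (a <= A)%N) (r_gt0 : (0 < r)%N).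

Let A_gt0 : (0 < A)%N := leq_trans a_gt0 le_aA.

Lemma gf_mes_ge k :
  gf (mes_ge r A a k) =
  qpochinf (- q) q / qpochinf q q *
  (2 ^+ k * q ^+ (r * (A * 'C(k, 2) + k * a)) / qpoch (- q ^+ a) (q ^+ A) k).
Proof.
have coef0 t : (0 < t)%N -> (- q ^+ t).[[0]] = 0.
  by move=> t0; rewrite fps_coefN (q_vanish t0) oppr0.
have qA0 : (q ^+ A).[[0]] = 0 by rewrite (q_vanish A_gt0).
rewrite -gf_predT [RHS]mulrA.
apply: (canRL (mulrK (qpoch_unit _ (coef0 _ a_gt0) qA0))).
rewrite qpochE ?coef0 //; elim: k => [|k IH].
  by rewrite big_ord0 mulr1 mul0n bin0n muln0 addn0 muln0 !expr0 !mulr1; apply: eq_gf.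
have C : insensitive_to (k * A + a) (mes_ge r A a k).
  move=> x p p' xt pp'; rewrite /mes_ge; apply: eq_in_all => j.
  rewrite mem_iota => /andP[_ jk]; rewrite /nparts (permP pp') /= xt.
  by rewrite eqn_add2r eqn_pmul2r // gtn_eqF.
have t0 : (0 < k * A + a)%N by rewrite addn_gt0 a_gt0 orbT.
(* [gf_atleast] uses a strict bound, so at least [r] parts corresponds to [r.-1]. *)
have := gf_atleast t0 C r.-1; rewrite prednK // -(eq_gf (mes_geS r A a k)) => ->.
rewrite big_ord_recr /= mulNr opprK -exprM -exprD mulrACA.
set U := gf _; set V := gf _.
(* The new factor of the denominator is absorbed by [gf_free], which lifts the ban on an overlined
   part of the new size. *)
have -> : U * (1 + q ^+ (a + A * k)) = gf (mes_ge r A a k).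
  by rewrite (gf_free t0 C) mulrC mulnC addnC.
transitivity (2 * q ^+ (r * (k * A + a)) *
    (gf (mes_ge r A a k) * \prod_(i < k) (1 - - q ^+ a * q ^+ A ^+ i))).
  by rewrite -mulrA [X in _ * X = _]mulrC.
rewrite IH exprS (_ : r * (A * 'C(k.+1, 2) + k.+1 * a) =
    r * (k * A + a) + r * (A * 'C(k, 2) + k * a))%N; last first.
  by rewrite binS bin1 -mulnDr mulSn; congr (_ * _)%N; rewrite mulnDr; lia.
by rewrite exprD mulrCA mulrACA.
Qed.

Lemma mes_index p : exists k,
  [/\ mes r A a p = (k * A + a)%N, (k <= weight p)%N
    & forall j, mes_ge r A a j p = (j <= k)%N].
Proof.
have [[m0 ma mr] mmin] := mesP a p A_gt0 r_gt0.
(* A value below [a] would be its own residue mod [A]: congruence then forces it to equal [a] if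
   [a < A], and to be 0 if [a = A]. *)
have le_am : (a <= mes r A a p)%N.
  rewrite leqNgt; apply/negP => ltma; move: ma; rewrite modn_small; last first.
    exact: leq_trans ltma le_aA.
  case: (ltngtP a A) le_aA => // [ltaA|eqaA] _; first by rewrite modn_small //; lia.
  by have -> : (a %% A = 0)%N; [rewrite eqaA modnn | lia].
have /dvdnP[k mk] : (A %| mes r A a p - a)%N by rewrite -eqn_mod_dvd //; apply/eqP.
have {}mk : mes r A a p = (k * A + a)%N by rewrite -mk subnK.
have lt_r j : (j < k)%N -> (r <= nparts p (j * A + a))%N.
  move=> jk; rewrite leqNgt; apply/negP => nr.
  have /mmin : mes_cond r A a p (j * A + a).
    by split=> //; [rewrite addn_gt0 a_gt0 orbT | rewrite modnMDl].
  by rewrite mk leq_add2r leq_pmul2r // leqNgt jk.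
exists k; split=> // [|j].
  (* For a positive index, the preceding size [k * A + a] occurs as a part, so the weight is at
     least [k.+1]. *)
  case: k lt_r {mk} => // k /(_ _ (ltnSn k)) /(leq_trans r_gt0) /nparts_gt0_le.
  by apply: leq_trans; nia.
apply/allP/idP => [H|jk i].
  rewrite leqNgt; apply/negP => kj; have := H k.
  by rewrite mem_iota kj -mk => /(_ isT); rewrite leqNgt mr.
by rewrite mem_iota => ij; apply: lt_r; lia.
Qed.

Lemma sum_mes_index n p : weight p = n ->
  \sum_(k < n.+1 | mes_ge r A a k p && ~~ mes_ge r A a k.+1 p) 'X^(k * A + a)
    = 'X^(mes r A a p) :> {poly int}.
Proof.
move=> wp; have [k [-> lekw mesE] ] := mes_index p.
have ltkn : (k < n.+1)%N by rewrite ltnS -wp.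
rewrite (big_pred1 (Ordinal ltkn)) // => j /=.
by rewrite !mesE -val_eqE /=; lia.
Qed.

End Mes.

(** * Coefficient extraction and the final summation *)

Lemma coef_z n : z.[[n]] = if n == 0%N then 'X else 0.
Proof. by []. Qed.

Lemma coef_zXM m (f : fps {poly int}) n : (z ^+ m * f).[[n]] = 'X^m * f.[[n]].
Proof.
elim: m => [|m IH]; first by rewrite !expr0 !mul1r.
rewrite !exprS -!mulrA -IH fps_coefM big_ord_recl subn0 big1 ?addr0 // => i _.
by rewrite coef_z mul0r.
Qed.

Lemma coef_qX w n : (q ^+ w).[[n]] = if w == n then 1 else 0.
Proof.
by rewrite -[q ^+ w]mulr1 coef_qXM fps_coef1 subn_eq0; case: ltngtP.
Qed.

Lemma fps_sum_seq (R : comNzRingType) (I : choiceType) (F : I -> fps R) n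
    (s : seq I) :
  uniq s -> (forall i, i \notin s -> (F i).[[n]] = 0) ->
  (fps_sum F).[[n]] = \sum_(i <- s) (F i).[[n]].
Proof.
move=> us Fs; rewrite /fps_sum {1}/fps_coef (fsbigE s) // => [|i _]; last exact: Fs.
by apply: eq_bigl => i; rewrite in_setT.
Qed.

(** Since [F k] starts in degree at least [k], only the members with [k <= n] reach degree [n], and
    the finite sums can be exchanged. *)
Lemma coef_mul_fps_sum (R : comNzRingType) (f : fps R) (F : nat -> fps R) n :
  (forall k, fps_vanish k (F k)) ->
  (f * fps_sum F).[[n]] = \sum_(k < n.+1) (f * F k).[[n]].
Proof.
move=> vF; rewrite fps_coefM.
under [RHS]eq_bigr => k _ do rewrite fps_coefM.
rewrite exchange_big /=; apply: eq_bigr => i _; rewrite -mulr_sumr; congr (_ * _).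
rewrite (fps_sum_seq (iota_uniq 0 n.+1)) => [|k].
  by rewrite -[iota 0 _]/(index_iota 0 n.+1) big_mkord.
by rewrite mem_iota /= add0n -leqNgt => nk; apply: vF; lia.
Qed.

Theorem theorem2p1 (A a r : nat) (ha : (1 <= a)%N) (haA : (a <= A)%N)
    (hr : (1 <= r)%N) :
  fps_sum (fun p : overpartition => z ^+ mes r A a p * q ^+ weight p) =
  qpochinf (- q) q / qpochinf q q *
  fps_sum (fun k : nat =>
    z ^+ (k * A + a) *
    (2 ^+ k * q ^+ (r * (A * 'C(k, 2) + k * a)) / qpoch (- q ^+ a) (q ^+ A) k
     - 2 ^+ k.+1 * q ^+ (r * (A * 'C(k.+1, 2) + k.+1 * a))
       / qpoch (- q ^+ a) (q ^+ A) k.+1)).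
Proof.
apply/fpsP => n; rewrite coef_mul_fps_sum => [|k]; last first.
  have vanish j c d : (k <= j)%N ->
      fps_vanish k (c * q ^+ (r * (A * 'C(j, 2) + j * a)) / d).
    move=> kj m mk; rewrite mulrAC; apply: (fps_vanishMl _ (@q_vanish _)).
    apply: (leq_trans mk); apply: (leq_trans kj).
    apply: (leq_trans (leq_pmulr j ha)).
    by apply: leq_trans (leq_addl _ _) (leq_pmull _ hr).
  apply: fps_vanishMl => m mk; rewrite fps_coefD fps_coefN.
  rewrite [X in X - _](vanish k _ _ (leqnn k) m mk).
  by rewrite [X in _ - X](vanish k.+1 _ _ (leqnSn k) m mk) subr0.
rewrite (fps_sum_seq (overpartitions_of_uniq n)) => [|p]; last first.
  by rewrite mem_overpartitions_of coef_zXM coef_qX => /negbTE ->; rewrite mulr0.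
(* The [k]-th term counts the overpartitions of [n] that satisfy [mes_ge] at [k] but not at [k.+1],
   each weighted by ['X^(k * A + a)]. *)
have termE k : (qpochinf (- q) q / qpochinf q q *
    (z ^+ (k * A + a) *
    (2 ^+ k * q ^+ (r * (A * 'C(k, 2) + k * a)) / qpoch (- q ^+ a) (q ^+ A) k
     - 2 ^+ k.+1 * q ^+ (r * (A * 'C(k.+1, 2) + k.+1 * a))
       / qpoch (- q ^+ a) (q ^+ A) k.+1))).[[n]] =
    \sum_(p <- overpartitions_of n)
      if mes_ge r A a k p && ~~ mes_ge r A a k.+1 p then 'X^(k * A + a) else 0.
  transitivity (z ^+ (k * A + a) *
      (gf (mes_ge r A a k) - gf (mes_ge r A a k.+1))).[[n]].
    congr (_ .[[ _ ]]); rewrite (gf_mes_ge ha haA hr k) (gf_mes_ge ha haA hr k.+1).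
    by rewrite -mulrBr [RHS]mulrCA.
  rewrite coef_zXM (gfID (mes_ge r A a k.+1)).
  rewrite (eq_gf (C := fun p => _ && mes_ge r A a k.+1 p) (D := mes_ge r A a k.+1)).
    rewrite addrC addKr gf_coef -big_mkcond big_const_seq iter_addr_0.
    by rewrite mulr_natr.
  by move=> p; rewrite mes_geS; case: (mes_ge r A a k p).
under [RHS]eq_bigr => k _ do rewrite termE.
(* After the exchange, each [p] is selected by exactly one [k], which lies in range because the
   index of [mes] is at most the weight [n]. *)
rewrite [RHS]exchange_big /= [LHS]big_seq [RHS]big_seq; apply: eq_bigr => p.
rewrite mem_overpartitions_of => /eqP wp.
by rewrite coef_zXM coef_qX wp eqxx mulr1 -big_mkcond sum_mes_index.
Qed.
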